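(* Let $p\in(1,\infty)$ and $\alpha=1-1/p>0$. Then for every $h\in W^{1,p}$, the map $$\omega(s,t)=|h|_{W^{1,p};[s,t]}\,(t-s)^{\alpha},\qquad 0\le s\le t\le 1,$$ is a control function, and the variation ($1$-variation) of $h$ is controlled by $\omega$, i.e. $|h|_{1\text{-var};[s,t]}\le \omega(s,t)$ for all $0\le s\le t\le 1$. Moreover, one has the continuous embeddings $$W^{1,p}\subset C^{\alpha\text{-H\''older}}\quad\text{and}\quad W^{1,p}\subset C^{1\text{-var}}.$$
   Context: All paths are real-valued functions on $[0,1]$. For $p\in(1,\infty)$, $W^{1,p}$ is the set of absolutely continuous paths $h:[0,1]\to\mathbb{R}$ whose a.e. defined derivative $\dot h$ lies in $L^p[0,1]$. For $0\le s\le t\le 1$ set $|h|_{W^{1,p};[s,t]}=\left(\int_s^t|\dot h_r|^p\,dr\right)^{1/p}$, and $|h|_{W^{1,p}}=|h|_{W^{1,p};[0,1]}$. $W^{1,p}$ is a Banach space with norm $|h|_{L^p}+|h|_{W^{1,p}}$. A control function is a continuous map $(s,t)\mapsto\omega(s,t)\in[0,\infty)$, defined for $0\le s\le t\le 1$, which is super-additive: $\omega(s,t)+\omega(t,u)\le\omega(s,u)$ for $s\le t\le u$. For $q\ge 1$, $|h|_{q\text{-var};[s,t]}=\sup\left(\sum_i|h_{t_{i+1}}-h_{t_i}|^q\right)^{1/q}$, the supremum being over all finite partitions $(t_i)$ of $[s,t]$. $C^{q\text{-var}}$ is the space of continuous paths $h$ with $|h|_{q\text{-var};[0,1]}<\infty$,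 with norm $\sup_{[0,1]}|h|+|h|_{q\text{-var};[0,1]}$. $C^{\alpha\text{-H\''older}}$ is the space of paths with $|h|_{\alpha\text{-H\''older}}=\sup_{0\le s<t\le1}|h_t-h_s|/|t-s|^\alpha<\infty$, with norm $\sup_{[0,1]}|h|+|h|_{\alpha\text{-H\''older}}$. A continuous embedding is an inclusion that is a bounded linear map. *)

(* Defs.v *)
From HB Require Import structures.
From mathcomp Require Import all_boot all_order all_algebra.
From mathcomp Require Import all_classical all_reals all_analysis.

Set Implicit Arguments.
Unset Strict Implicit.
Unset Printing Implicit Defensive.

Import Order.TTheory GRing.Theory Num.Theory.
Import numFieldNormedType.Exports.

Local Open Scope classical_set_scope.
Local Open Scope ring_scope.

(* A path on [0, 1] is represented by a function h : R -> R.  All notions below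
   depend only on the restriction of h to [0, 1]: derivatives are integrated
   over subintervals of [0, 1], where the endpoints are negligible. *)

Section paths.
Context {R : realType}.
Implicit Types (h : R -> R) (w : R -> R -> R) (p q alpha s t : R).
Local Notation mu := (@lebesgue_measure R).

Definition abs_continuous (a b : R) h : Prop :=
  forall e : R, 0 < e -> exists2 d : R, 0 < d &
    forall (n : nat) (u v : 'I_n -> R),
      (forall i, [/\ a <= u i, u i < v i & v i <= b]) ->
      trivIset [set: 'I_n] (fun i => `]u i, v i[%classic) ->
      \sum_(i < n) (v i - u i) < d ->
      \sum_(i < n) `|h (v i) - h (u i)| < e.

(* (\int_s^t |f|^p)^(1/p) *)
Definition Lp_norm p s t (f : R -> R) : \bar R :=
  'N[mu]_(p%:E)[EFin \o (f \_ `[s, t])].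

(* The library's derivative derive1 h is total, with the value 0 at the points where
   h has no derivative; for an absolutely continuous path these points of
   [0, 1] form a null set. *)
Definition W1p_seminorm p s t h : \bar R := Lp_norm p s t (derive1 h).

Definition W1p p : set (R -> R) :=
  [set h | abs_continuous 0 1 h /\ derive1 h \_ `[0, 1] \in Lfun mu p%:E].

Definition W1p_norm p h : \bar R := (Lp_norm p 0 1 h + W1p_seminorm p 0 1 h)%E.

Definition simplex : set (R * R) :=
  [set st | [/\ 0 <= st.1, st.1 <= st.2 & st.2 <= 1]].

Definition is_control w : Prop :=
  [/\ {within simplex, continuous (fun st : R * R => w st.1 st.2)},
      forall s t, 0 <= s -> s <= t -> t <= 1 -> 0 <= w s t
    & forall s t u, 0 <= s -> s <= t -> t <= u -> u <= 1 ->
        w s t + w t u <= w s u].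

(* As in the library, a partition s = t_0 < t_1 < ... < t_n = t of [s, t] is
   given by the list l = [:: t_1; ...; t_n], so that t_i = nth t (s :: l) i. *)
Definition qvar q s t h : \bar R :=
  ereal_sup [set ((\sum_(0 <= i < size l)
      `|h (nth t (s :: l) i.+1) - h (nth t (s :: l) i)| `^ q) `^ q^-1)%:E
    | l in itv_partition s t].

Lemma qvar1 s t h : qvar 1 s t h = total_variation s t h.
Proof.
rewrite /qvar /total_variation; congr ereal_sup.
have E l : (\sum_(0 <= i < size l)
    `|h (nth t (s :: l) i.+1) - h (nth t (s :: l) i)| `^ 1) `^ 1^-1 =
    variation s t h l :> R.
  rewrite invr1 powRr1; last by apply: sumr_ge0 => i _; exact: powR_ge0.
  by apply: eq_bigr => i _; rewrite powRr1.
apply/seteqP; split => [_ [l sl <-]|_ [_ [l sl <-] <-]].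
  by rewrite E; exists (variation s t h l) => //; exists l.
by exists l => //; rewrite E.
Qed.

Definition sup_norm h : \bar R :=
  ereal_sup [set `|h t|%:E | t in `[0, 1]%classic].

Definition Cqvar q : set (R -> R) :=
  [set h | {within `[(0 : R), 1], continuous h} /\ (qvar q 0 1 h < +oo)%E].

Definition Cqvar_norm q h : \bar R := (sup_norm h + qvar q 0 1 h)%E.

Definition hoelder_seminorm alpha h : \bar R :=
  ereal_sup [set (`|h st.2 - h st.1| / `|st.2 - st.1| `^ alpha)%:E
    | st in [set st : R * R | [/\ 0 <= st.1, st.1 < st.2 & st.2 <= 1]]].

Definition Choelder alpha : set (R -> R) :=
  [set h | (hoelder_seminorm alpha h < +oo)%E].

Definition Choelder_norm alpha h : \bar R :=
  (sup_norm h + hoelder_seminorm alpha h)%E.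

(* The operations on paths being pointwise in every space, linearity of the
   inclusion is automatic; what remains is that it is defined and bounded. *)
Definition continuous_embedding (E : set (R -> R)) (normE : (R -> R) -> \bar R)
    (F : set (R -> R)) (normF : (R -> R) -> \bar R) : Prop :=
  E `<=` F /\
  exists C : R, forall h, E h -> (normF h <= C%:E * normE h)%E.

End paths.

(* Main.v *)
(* The 1-variation V of an absolutely continuous h is again absolutely
   continuous, so V and V - h are nondecreasing and absolutely continuous.  The
   Lebesgue-Stieltjes measure of such a function is dominated by the Lebesgue
   measure, hence has a Radon-Nikodym density; thus h is the integral of some
   integrable g, and g = h' almost everywhere by Lebesgue differentiation.
   Hoelder's inequality then bounds |h_t - h_s| <= \int_s^t |h'| by omega(s, t).
   Hoelder's inequality for two terms makes omega super-additive, which passes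
   from increments to the 1-variation.  For the sup norm, average
   |h_t| <= |h_s| + |h|_{W^{1,p}} over s. *)
From HB Require Import structures.
Require Import Defs.
From mathcomp Require Import all_boot all_order all_algebra.
From mathcomp Require Import all_classical all_reals all_analysis.
From mathcomp Require Import measurable_realfun lra.
Set Implicit Arguments.
Unset Strict Implicit.
Unset Printing Implicit Defensive.
Import Order.TTheory GRing.Theory Num.Theory.
Import numFieldNormedType.Exports.
Local Open Scope classical_set_scope.
Local Open Scope ring_scope.

Section absolute_continuity.
Context {R : realType}.
Implicit Types (a b e s t x : R) (h G : R -> R).

Lemma abs_continuous_fin a b h e : abs_continuous a b h -> 0 < e ->
  exists2 d : R, 0 < d & forall (I : finType) (u v : I -> R),
    (forall i, [/\ a <= u i, u i <= v i & v i <= b]) ->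
    trivIset [set: I] (fun i => `]u i, v i[%classic) ->
    \sum_i (v i - u i) < d -> \sum_i `|h (v i) - h (u i)| < e.
Proof.
move=> ach e0; have [d d0 acd] := ach e e0.
exists d => // I u v uv tuv uvd; pose A := [pred i | u i < v i].
have sumE (F : I -> R) : (forall i, ~~ A i -> F i = 0) ->
    \sum_i F i = \sum_(k < #|A|) F (enum_val k).
  move=> F0; rewrite -big_enum_val [LHS](bigID A)/= [X in _ + X]big1 ?addr0//.
have uvA i : ~~ A i -> v i = u i.
  rewrite /A/= -leNgt => vu; apply/eqP; rewrite eq_le vu/=.
  by case: (uv i).
rewrite sumE => [|i /uvA ->]; last by rewrite subrr normr0.
apply: acd.
- by move=> k; case: (uv (enum_val k)) => au _ vb; split => //; exact: (enum_valP k).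
- apply/trivIsetP => i j _ _ ij; move/trivIsetP : tuv; apply => //.
  by rewrite (inj_eq enum_val_inj).
- by rewrite -(sumE (fun i => v i - u i))// => i /uvA ->; rewrite subrr.
Qed.

Lemma abs_continuousS a b s t h : a <= s -> t <= b ->
  abs_continuous a b h -> abs_continuous s t h.
Proof.
move=> as_ tb ach e /ach[d d0 acd]; exists d => // n u v uv; apply: acd => i.
by have [su ? vt] := uv i; rewrite (le_trans as_ su) (le_trans vt tb).
Qed.

Lemma abs_continuousN a b h : abs_continuous a b h -> abs_continuous a b (\- h).
Proof.
move=> ach e /ach[d d0 acd]; exists d => // n u v uv tuv uvd.
by under eq_bigr do rewrite /= -opprD normrN; exact: acd.
Qed.

Lemma abs_continuousD a b h G : abs_continuous a b h -> abs_continuous a b G ->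
  abs_continuous a b (h \+ G).
Proof.
move=> ach acG e e0; have e20 : 0 < e / 2 by rewrite divr_gt0.
have [d d0 acd] := ach _ e20; have [d' d'0 acd'] := acG _ e20.
exists (Num.min d d'); first by rewrite lt_min d0.
move=> n u v uv tuv; rewrite lt_min => /andP[uvd uvd'].
rewrite [ltRHS]splitr; apply: le_lt_trans (ltrD (acd _ _ _ uv tuv uvd) (acd' _ _ _ uv tuv uvd')).
rewrite -big_split/=; apply: ler_sum => i _.
by rewrite opprD addrACA ler_normD.
Qed.

Lemma abs_continuous_dist a b h e : abs_continuous a b h -> 0 < e ->
  exists2 d : R, 0 < d & forall x y, a <= x <= b -> a <= y <= b ->
    `|x - y| < d -> `|h x - h y| < e.
Proof.
move=> ach /(abs_continuous_fin ach)[d d0 acd]; exists d => // x y.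
wlog xy : x y / y <= x.
  move=> wl; have [yx|/ltW xy xab yab] := leP y x; first exact: wl.
  by rewrite distrC (distrC (h x)); exact: wl.
move=> /andP[ax xb] /andP[ay yb] xyd.
have := @acd unit (fun=> y) (fun=> x); rewrite !big_const card_unit/= !addr0.
apply => //.
- by apply/trivIsetP => -[] [].
- by rewrite -[ltLHS]ger0_norm// subr_ge0.
Qed.

Lemma abs_continuous_within (a b : R) (G : R -> R) : abs_continuous a b G ->
  {within `[a, b], continuous G}.
Proof.
move=> acG; apply/subspace_continuousP => x xab.
apply/cvgrPdist_lt => e e0; have [d d0 acd] := abs_continuous_dist acG e0.
rewrite near_withinE; apply: filterS (nbhsx_ballx x d d0) => y xyd yab.
by apply: acd => //; move: xab yab; rewrite /= !in_itv.
Qed.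

Lemma itv_partition_trivIset s t (l : seq R) : itv_partition s t l ->
  trivIset [set: 'I_(size l)]
    (fun i => `]nth t (s :: l) i, nth t (s :: l) i.+1[%classic).
Proof.
move=> [sl _]; apply/trivIsetP => i j _ _.
wlog ij : i j / (i < j)%N.
  move=> wl; rewrite neq_lt => /orP[] ij; first by apply: wl => //; rewrite lt_eqF.
  by rewrite setIC; apply: wl => //; rewrite lt_eqF.
move=> _; apply/seteqP; split => // x/= []; rewrite !in_itv/=.
move=> /andP[_ xi] /andP[jx _]; have := lt_trans jx xi; apply/negP; rewrite -leNgt.
have sl' : sorted <%O (s :: l) by [].
change (nth t (s :: l) i.+1 <= nth t (s :: l) j).
by rewrite (lt_sorted_leq_nth t sl')// inE/= ltnS// ltnW.
Qed.

Lemma itv_partition_sub s t (l : seq R) (i : 'I_(size l)) : itv_partition s t l ->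
  [/\ s <= nth t (s :: l) i, nth t (s :: l) i <= nth t (s :: l) i.+1
    & nth t (s :: l) i.+1 <= t].
Proof.
move=> [sl /eqP lt]; have sl' : sorted <%O (s :: l) by [].
have st k : (k <= size l)%N -> s <= nth t (s :: l) k.
  by move=> kl; rewrite -[leLHS]/(nth t (s :: l) 0) (lt_sorted_leq_nth t sl').
have tn : t = nth t (s :: l) (size l) by rewrite -[in LHS]lt (last_nth t).
split; first by rewrite st// ltnW.
- by rewrite (lt_sorted_leq_nth t sl') ?inE//= ltnS// ltnW.
- by rewrite [leRHS]tn (lt_sorted_leq_nth t sl') ?inE//= ltnS.
Qed.

Lemma itv_partition_telescope s t (l : seq R) G : itv_partition s t l ->
  \sum_(i < size l) (G (nth t (s :: l) i.+1) - G (nth t (s :: l) i)) = G t - G s.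
Proof.
move=> [_ /eqP lt].
rewrite -(big_mkord xpredT (fun i => G (nth t (s :: l) i.+1) - G (nth t (s :: l) i))).
by rewrite telescope_sumr//= -(last_nth t) lt.
Qed.

End absolute_continuity.

Section total_variation_abs_continuous.
Context {R : realType}.
Implicit Types (a b e s t x : R) (h : R -> R).
Local Notation TV := total_variation.
Local Notation BV := bounded_variation.

Lemma abs_continuous_variation a b h e : abs_continuous a b h -> 0 < e ->
  exists2 d : R, 0 < d & forall (I : finType) (u v : I -> R) (l : I -> seq R),
    (forall i, [/\ a <= u i, u i <= v i & v i <= b]) ->
    (forall i, itv_partition (u i) (v i) (l i)) ->
    trivIset [set: I] (fun i => `]u i, v i[%classic) ->
    \sum_i (v i - u i) < d -> \sum_i variation (u i) (v i) h (l i) < e.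
Proof.
move=> ach /(abs_continuous_fin ach)[d d0 acd].
exists d => // I u v l uv uvl tuv uvd.
(* The points of all the partitions l i cut out one family of disjoint intervals. *)
pose J : finType := {i : I & 'I_(size (l i))}.
pose w i k := nth (v i) (u i :: l i) k.
pose U (p : J) := w (tag p) (tagged p).
pose V (p : J) := w (tag p) (tagged p).+1.
have sumJ (F : R -> R -> R) : \sum_(p : J) F (V p) (U p) =
    \sum_i \sum_(k < size (l i)) F (w i k.+1) (w i k).
  by rewrite sig_big_dep.
rewrite (_ : \sum_i _ = \sum_(p : J) `|h (V p) - h (U p)|); last first.
  rewrite (sumJ (fun y x => `|h y - h x|)); apply: eq_bigr => i _.
  by rewrite /variation big_mkord.
apply: acd.
- move=> [i k]; have [uw ww wv] := itv_partition_sub k (uvl i).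
  have [au _ vb] := uv i.
  by split => //; [exact: le_trans uw|exact: le_trans vb].
- apply/trivIsetP => -[i k] [j m] _ _; have [ij|ij _] := eqVneq i j.
    subst j => ikm; move/trivIsetP : (itv_partition_trivIset (uvl i)) => /(_ k m Logic.I Logic.I).
    by apply; apply: contraNN ikm => /eqP ->.
  move/trivIsetP : tuv => /(_ i j Logic.I Logic.I ij).
  apply: subsetI_eq0.
  + have [uw _ wv] := itv_partition_sub k (uvl i).
    by apply: subset_itvW.
  + have [uw _ wv] := itv_partition_sub m (uvl j).
    by apply: subset_itvW.
- rewrite (sumJ (fun y x => y - x)); rewrite (eq_bigr (fun i => v i - u i))// => i _.
  by rewrite (itv_partition_telescope id).
Qed.

Lemma abs_continuous_bounded_variation a b h : a <= b ->
  abs_continuous a b h -> BV a b h.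
Proof.
move=> ab ach; have [d d0 acd] := abs_continuous_variation ach ltr01.
have small s t : a <= s -> s <= t -> t <= b -> t - s < d -> TV s t h \is a fin_num.
  move=> as_ st tb std; apply/bounded_variationP => //; exists 1 => _ [l stl <-].
  have := @acd unit (fun=> s) (fun=> t) (fun=> l).
  rewrite !big_const card_unit/= !addr0 => /(_ _ _ _ std) H; apply/ltW/H => //.
  by apply/trivIsetP => -[] [].
have d20 : 0 < d / 2 by rewrite divr_gt0.
have [n nP] : exists n, b - a < n%:R * (d / 2).
  exists (Num.truncn ((b - a) / (d / 2))).+1.
  by rewrite -ltr_pdivrMr// truncnS_gt.
apply/bounded_variationP => //.
elim: n b ab nP {ach acd} small => [|n ih] b ab; first by rewrite mul0r subr_lt0 ltNge ab.
move=> bn small; pose y := Num.max a (b - d / 2).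
have ay : a <= y by rewrite le_max lexx.
have yb : y <= b by rewrite ge_max ab/= lerBlDr lerDl ltW.
rewrite (total_variationD h ay yb) fin_numD; apply/andP; split; last first.
  apply: small => //; rewrite ltrBlDr -ltrBlDl lt_max; apply/orP; right.
  by rewrite ltrD2l ltrN2 ltr_pdivrMr// ltr_pMr// ltr1n.
have [ba|ba] := leP (b - d / 2) a.
  by rewrite /y (max_idPl ba) total_variationxx.
apply: ih => //.
  rewrite /y (max_idPr (ltW ba)) addrAC ltrBlDr.
  by move: bn; rewrite -natr1 mulrDl mul1r.
by move=> s t as_ st ty; apply: small => //; exact: le_trans ty yb.
Qed.

Lemma total_variation_fin_num a b s t h : abs_continuous a b h ->
  a <= s -> s <= t -> t <= b -> TV s t h \is a fin_num.
Proof.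
move=> ach as_ st tb; apply/bounded_variationP => //.
exact/abs_continuous_bounded_variation/(abs_continuousS as_ tb).
Qed.

Lemma fine_total_variationB a b s t h : abs_continuous a b h ->
  a <= s -> s <= t -> t <= b ->
  fine (TV a t h) - fine (TV a s h) = fine (TV s t h).
Proof.
move=> ach as_ st tb; rewrite (total_variationD h as_ st) fineD.
- by rewrite addrC addKr.
- exact: (total_variation_fin_num ach) (le_trans st tb).
- exact: (total_variation_fin_num ach).
Qed.

Lemma total_variation_abs_continuous a b h :
  abs_continuous a b h -> abs_continuous a b (fun x => fine (TV a x h)).
Proof.
move=> ach e e0; have e20 : 0 < e / 2 by rewrite divr_gt0.
have [d d0 acd] := abs_continuous_variation ach e20.
exists d => // n u v uv tuv uvd.
have fuv i : TV (u i) (v i) h \is a fin_num.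
  by have [au /ltW uvi vb] := uv i; exact: (total_variation_fin_num ach).
pose r := e / 2 / n.+1%:R; have r0 : 0 < r by rewrite divr_gt0.
have lP i : exists l, itv_partition (u i) (v i) l /\
    fine (TV (u i) (v i) h) <= variation (u i) (v i) h l + r.
  have [_ [_ [l uvl <-] <-] H] := ub_ereal_sup_adherent r0 (fuv i).
  exists l; split => //; rewrite -lerBlDr -lee_fin EFinB fineK//.
  exact: ltW.
have [l {}lP] := choice lP.
apply: (@le_lt_trans _ _ (\sum_i (variation (u i) (v i) h (l i) + r))).
  apply: ler_sum => i _; have [au /ltW uvi vb] := uv i; have [_] := lP i.
  rewrite (fine_total_variationB ach)// ger0_norm//.
  by rewrite fine_ge0// total_variation_ge0.
rewrite big_split/= [ltRHS]splitr ltr_leD//.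
  apply: acd => // i; last by have [] := lP i.
  by have [? /ltW] := uv i.
rewrite sumr_const card_ord /r -mulrnAr ler_piMr ?(ltW e20)//.
by rewrite -mulr_natr mulrC ler_pdivrMr// mul1r ler_nat.
Qed.

End total_variation_abs_continuous.

Section lebesgue_stieltjes_density.
Context {R : realType}.
Implicit Types (a b x y : R) (F : cumulative R R) (A X : set R).
Local Notation mu := (@lebesgue_measure R).

Lemma open_is_interval_itv_oo X : open X -> is_interval X -> (mu X < +oo)%E ->
  exists x y, x <= y /\ X = `]x, y[%classic.
Proof.
move=> oX /is_intervalP XE muX.
have -> : X = (X°)%classic by exact/esym/interior_id.
rewrite XE in muX *; case: (Rhull X) muX => [[c x|[]] [d y|[]]].
- rewrite interior_itv => _; have [xy|/ltW yx] := leP x y; first by exists x, y.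
  by exists x, x; split => //; rewrite !set_itv_ge// bnd_simp -leNgt.
all: try by rewrite lebesgue_measure_itv/= ?ltry ?ltNyr ?ltxx ?ltxx.
all: by exists 0, 0; split => //; rewrite !set_itvE interior0.
Qed.

Lemma lebesgue_stieltjes_measure_itv_oc F x y : x <= y ->
  lebesgue_stieltjes_measure F (`]x, y]%classic : set R) = (F y - F x)%:E.
Proof.
move=> xy; rewrite /lebesgue_stieltjes_measure /measure_extension.
rewrite (measurable_mu_extE (wlength F)); last exact: is_ocitv.
exact: wlength_itv_bnd.
Qed.

(* Up to measure less than d, a null set is covered by an open set, which is a
   disjoint union of open intervals on finitely many of which F varies by < e. *)
Lemma lebesgue_stieltjes_measure_null F :
  (forall e : R, 0 < e -> exists2 d : R, 0 < d &
     forall (n : nat) (u v : 'I_n -> R), (forall i, u i <= v i) ->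
     trivIset [set: 'I_n] (fun i => `]u i, v i[%classic) ->
     \sum_(i < n) (v i - u i) < d -> \sum_(i < n) (F (v i) - F (u i)) < e) ->
  forall A, measurable A -> mu A = 0%E -> lebesgue_stieltjes_measure F A = 0%E.
Proof.
move=> acF A mA muA0.
apply/eqP; rewrite eq_le measure_ge0 andbT; apply/lee_addgt0Pr => e e0.
rewrite add0e; have [d d0 acd] := acF _ e0.
have muAy : (mu A < +oo)%E by rewrite muA0 ltry.
have [U [oU AU]] := lebesgue_regularity_outer mA muAy d0.
have mU : measurable U by exact: open_measurable.
move=> muUA; have muU : (mu U < d%:E)%E.
  rewrite (_ : mu U = mu (U `\` A)); first exact: muUA.
  apply: (etrans (measureDI mu mU mA)); rewrite -[RHS]adde0; congr (_ + _)%E.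
  apply/eqP; rewrite eq_le measure_ge0 andbT -[leRHS]muA0.
  apply: le_measure; rewrite ?inE//.
  exact: (measurableI U A mU mA).
pose X := open_disjoint_itv oU.
have mX n : measurable (X n) by apply: open_measurable; exact: open_disjoint_itv_open.
have XU n : X n `<=` U.
  by rewrite [in X in _ `<=` X](open_disjoint_itv_bigcup oU); exact: bigcup_sup.
have /choice[x xP] n : exists x, exists y, x <= y /\ X n = `]x, y[%classic.
  apply: open_is_interval_itv_oo; [exact: open_disjoint_itv_open|
    exact: open_disjoint_itv_is_interval|].
  apply: le_lt_trans (lt_trans muU (ltry _)).
  by apply: le_measure; rewrite ?inE; [exact: mX|exact: mU|exact: XU].
have {xP}/choice[y xyP] := xP.
have muX n : mu (X n) = (y n - x n)%:E.
  have [xy ->] := xyP n; rewrite lebesgue_measure_itv/= lte_fin.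
  by case: ltgtP xy => // ->; rewrite subrr.
have tX : trivIset setT X by exact: open_disjoint_itv_trivIset.
apply: (@le_trans _ _ (lebesgue_stieltjes_measure F U)).
  by apply: le_measure; rewrite ?inE.
rewrite [in leLHS](open_disjoint_itv_bigcup oU).
rewrite measure_bigcup; [|by move=> i _; exact: mX|exact: tX].
apply: lime_le.
  by apply: is_cvg_nneseries.
apply: nearW => n; rewrite big_mkord.
apply: (@le_trans _ _ (\sum_(i < n) (F (y i) - F (x i))%:E)%E).
  rewrite big_mkcond/=; apply: lee_sum => i _; rewrite in_setT.
  have [xy XE] := xyP i; rewrite -lebesgue_stieltjes_measure_itv_oc//.
  rewrite -/(X i) XE le_measure ?inE//.
  exact: subset_itv_oo_oc.
rewrite sumEFin lee_fin ltW//; apply: acd => [i||].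
- by have [] := xyP i.
- apply/trivIsetP => i j _ _ ij; have [_ <-] := xyP i; have [_ <-] := xyP j.
  by move/trivIsetP : tX; apply.
- rewrite -lte_fin; apply: le_lt_trans muU.
  rewrite [leRHS](_ : _ = mu (\bigcup_n X n)); last first.
    by rewrite -(open_disjoint_itv_bigcup oU).
  rewrite measure_bigcup; [|by move=> i _; exact: mX|exact: tX].
  have := @nneseries_lim_ge R (mu \o X) (fun i => i \in [set: nat]) 0 n
    (fun _ _ _ => measure_ge0 mu _).
  apply: le_trans.
  rewrite big_mkord -sumEFin [leRHS]big_mkcond/=; apply: lee_sum => i _.
  by rewrite in_setT muX.
Qed.

Lemma nondecreasing_abs_continuous_density a b (G : R -> R) : a <= b ->
  {in `[a, b] &, nondecreasing_fun G} -> abs_continuous a b G ->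
  exists2 g : R -> R, mu.-integrable [set: R] (EFin \o g) &
    forall x, a <= x <= b -> G x - G a = \int[mu]_(t in `]a, x]) g t.
Proof.
move=> ab ndG acG; pose c x := Num.max a (Num.min x b).
have cab x : a <= c x <= b.
  by rewrite le_max lexx/= ge_max ab/= ge_min lexx orbT.
have cE x : a <= x <= b -> c x = x.
  by move=> /andP[ax xb]; rewrite /c (min_idPl xb) (max_idPr ax).
have c_nd x y : x <= y -> c x <= c y.
  by move=> xy; rewrite ge_max !le_max lexx/= orbC le_min !ge_min xy !lexx !orbT.
have c_lip x y : x <= y -> c y - c x <= y - x.
  move=> xy; rewrite /c.
  case: (leP x b) => ?; case: (leP y b) => ?; case: (leP a x) => ?;
    case: (leP a y) => ?; case: (leP a b) => ?; lra.
have c_sub x y : `]c x, c y[ `<=` `]x, y[.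
  move=> z /=; rewrite !in_itv/= /c gt_max lt_max gt_min lt_min.
  by case/andP=> /andP[az /orP[xz|bz]] /orP[za|/andP[zy zb]]; apply/andP; lra.
have c_dist x y : `|c x - c y| <= `|x - y|.
  wlog xy : x y / x <= y.
    move=> wl; have [|/ltW] := leP x y; first exact: wl.
    by rewrite distrC (distrC x); exact: wl.
  rewrite distrC (distrC x) !ger0_norm ?subr_ge0//; [exact: c_lip|exact: c_nd].
have nd : {homo (G \o c) : x y / x <= y}.
  by move=> x y xy /=; apply: ndG (c_nd _ _ xy); rewrite in_itv/=.
have rc : right_continuous (G \o c).
  apply: right_continuousW => x; apply/cvgrPdist_lt => e e0.
  have [d d0 acd] := abs_continuous_dist acG e0.
  apply: filterS (nbhsx_ballx x d d0) => y xyd; apply: acd => //.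
  exact: le_lt_trans (c_dist x y) xyd.
pose F : cumulative R R := HB.pack (G \o c) (isCumulative.Build _ _ _ _ nd rc).
have null : forall A, measurable A -> mu A = 0%E ->
    lebesgue_stieltjes_measure F A = 0%E.
  apply: lebesgue_stieltjes_measure_null => e e0.
  have [d d0 acd] := abs_continuous_fin acG e0.
  exists d => // n u v uv tuv uvd.
  rewrite (eq_bigr (fun i => `|G (c (v i)) - G (c (u i))|)); last first.
    by move=> i _; rewrite ger0_norm// subr_ge0; exact: (cumulative_is_nondecreasing F).
  apply: acd.
  - move=> i; have /andP[? ?] := cab (u i); have /andP[? ?] := cab (v i).
    by split => //; exact: c_nd.
  - apply/trivIsetP => i j _ _ ij; move/trivIsetP : tuv => /(_ i j Logic.I Logic.I ij).
    apply: subsetI_eq0.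
    + exact: c_sub.
    + exact: c_sub.
  - by apply: le_lt_trans uvd; apply: ler_sum => i _; exact: c_lip.
pose D : set (measurableTypeR R) := `]a, b]%classic.
have mD : measurable D by exact: measurable_itv.
have FD : (lebesgue_stieltjes_measure F D < +oo)%E.
  by rewrite lebesgue_stieltjes_measure_itv_oc// ltry.
pose nu : {finite_measure set (measurableTypeR R) -> \bar R} := mfrestr mD FD.
have /radon_nikodym_sigma_finite[g [g0 gfin ig gE]] : nu `<< mu.
  apply/null_content_dominatesP => A mA muA0; rewrite /nu/= /mfrestr/mrestr.
  apply: null; first exact: measurableI.
  apply/eqP; rewrite eq_le measure_ge0 andbT -[leRHS]muA0.
  by apply: le_measure; rewrite ?inE//; exact: measurableI.
exists (fine \o g).
  by apply: eq_integrable ig => // x _ /=; rewrite fineK.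
move=> x xab; rewrite /Rintegral.
under eq_integral do rewrite /= fineK//.
rewrite -gE// /nu/= /mfrestr/mrestr; have /andP[ax xb] := xab.
rewrite (_ : _ `&` _ = `]a, x]%classic).
  by rewrite lebesgue_stieltjes_measure_itv_oc//= !cE ?lexx.
by apply/setIidl/subset_itvl; rewrite bnd_simp.
Qed.

End lebesgue_stieltjes_density.

Section fundamental_theorem.
Context {R : realType}.
Implicit Types (a b s t x : R) (h g : R -> R).
Local Notation mu := (@lebesgue_measure R).
Local Notation TV := total_variation.

Lemma abs_continuous_density a b h : a <= b -> abs_continuous a b h ->
  exists2 g : R -> R, mu.-integrable [set: R] (EFin \o g) &
    forall x, a <= x <= b -> h x - h a = \int[mu]_(t in `]a, x]) g t.
Proof.
move=> ab ach; pose V x := fine (TV a x h).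
have VB x y : a <= x -> x <= y -> y <= b -> `|h y - h x| <= V y - V x.
  move=> ax xy yb; rewrite (fine_total_variationB ach)// -lee_fin fineK.
    exact: total_variation_ge.
  exact: (total_variation_fin_num ach).
have acV : abs_continuous a b V := total_variation_abs_continuous ach.
have ndV : {in `[a, b] &, nondecreasing_fun V}.
  move=> x y; rewrite !in_itv/= => /andP[ax xb] /andP[ay yb] xy.
  by rewrite -subr_ge0 (le_trans _ (VB _ _ ax xy yb)).
have ndVh : {in `[a, b] &, nondecreasing_fun (V \- h)}.
  move=> x y; rewrite !in_itv/= => /andP[ax xb] /andP[ay yb] xy.
  rewrite -subr_ge0 opprD addrACA -opprD subr_ge0.
  exact: le_trans (ler_norm _) (VB _ _ ax xy yb).
have [g1 ig1 g1E] := nondecreasing_abs_continuous_density ab ndV acV.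
have [g2 ig2 g2E] := nondecreasing_abs_continuous_density ab ndVh
  (abs_continuousD acV (abs_continuousN ach)).
exists (g1 \- g2).
  by rewrite (_ : _ \o _ = (EFin \o g1) \- (EFin \o g2))%E//; exact: integrableB.
move=> x xab; rewrite RintegralB//; last 2 first.
- exact: integrableS ig1.
- exact: integrableS ig2.
by rewrite -g1E// -g2E//=; lra.
Qed.

Lemma abs_continuous_derivable a b h g :
  mu.-integrable [set: R] (EFin \o g) ->
  (forall x, a <= x <= b -> h x - h a = \int[mu]_(t in `]a, x]) g t) ->
  {ae mu, forall x, a < x < b -> derivable h x 1 /\ derive1 h x = g x}.
Proof.
move=> ig hE.
have lg : locally_integrable [set: R] g.
  by rewrite -(patch_setT (fun=> 0) g); exact: integrable_locally.
have ig' y : mu.-integrable [set` Interval (BRight a) (BRight y)] (EFin \o g).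
  exact: integrableS ig.
have := FTC1 ig' lg; apply: filterS; first exact: (ae_filter_ringOfSetsType mu).
move=> x /= + /andP[ax xb].
rewrite lte_fin => /(_ ax); set F := (fun _ => _) => -[dF FE].
have near_hF : {near x, (fun y => F y + h a) =1 h}.
  near=> y; rewrite /F -hE ?subrK//.
  apply/andP; split; apply/ltW; near: y; [exact: lt_nbhsr|exact: lt_nbhsl].
pose G : R -> R := F + cst (h a).
have dF1 : @derivable R R R F x 1 by exact: dF.
have dG : @derivable R R R G x 1.
  exact: (@derivableD R R R F (cst (h a)) x 1 dF1 (derivable_cst _ _ _)).
have GE : @derive R R R G x 1 = g x.
  rewrite (@deriveD R R R F (cst (h a)) x 1 dF1 (derivable_cst _ _ _)).
  by rewrite derive_cst addr0 -derive1E.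
split; first exact: (@near_eq_derivable R R R G h).
by rewrite derive1E -GE; apply/esym/(@near_eq_derive R R R G h).
Unshelve. all: by end_near. Qed.

Lemma abs_continuous_dist_le_integral a b h s t : abs_continuous a b h ->
  measurable_fun `[a, b] (derive1 h) -> a <= s -> s <= t -> t <= b ->
  (`|h t - h s|%:E <= \int[mu]_(x in `[s, t]) `|derive1 h x|%:E)%E.
Proof.
move=> ach mh as_ st tb; have ab := le_trans as_ (le_trans st tb).
have [g ig hE] := abs_continuous_density ab ach.
have mg : measurable_fun [set: R] g by apply/measurable_EFinP; exact: (measurable_int mu).
have igst (i : interval R) : mu.-integrable [set` i] (EFin \o g).
  exact: integrableS ig.
have -> : h t - h s = \int[mu]_(x in `]s, t[) g x.
  rewrite Rintegral_itv_bndo_bndc//.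
  rewrite -(@Rintegral_itvB _ g (BRight a) (BRight t) s) ?bnd_simp//.
  by rewrite -!hE ?as_ ?tb ?(le_trans _ st) ?(le_trans st)//; lra.
have mabs c d : measurable_fun [set` Interval (BSide c s) (BSide d t)]
    (fun x => `|derive1 h x|%:E).
  apply/measurable_EFinP/measurableT_comp => //.
  apply: measurable_funS mh => //.
  by apply: subset_itv; rewrite bnd_simp.
(* Pass to ]s, t[: derive1 h and g are only compared inside ]a, b[. *)
have -> : (\int[mu]_(x in `[s, t]) `|derive1 h x|%:E =
          \int[mu]_(x in `]s, t[) `|g x|%:E)%E.
  rewrite -integral_itv_obnd_cbnd// -integral_itv_bndo_bndc//.
  apply: ae_eq_integral => //.
  - exact: mabs.
  - by apply/measurable_EFinP/measurableT_comp => //; exact: measurable_funTS.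
  have := abs_continuous_derivable ig hE; apply: filterS.
    exact: (ae_filter_ringOfSetsType mu).
  move=> x /= H; rewrite in_itv/= => /andP[sx xt].
  by have [|_ ->] := H; rewrite ?(le_lt_trans as_ sx) ?(lt_le_trans xt tb).
rewrite EFin_normr_Rintegral//; apply: le_abse_integral => //.
exact: (measurable_int mu).
Qed.

End fundamental_theorem.

Section Lp_norm.
Context {R : realType}.
Implicit Types (p s t : R) (f h : R -> R).
Local Notation mu := (@lebesgue_measure R).

Lemma Lp_normE p s t f : p != 0 ->
  Lp_norm p s t f = ((\int[mu]_(x in `[s, t]) (`|f x| `^ p)%:E) `^ p^-1)%E.
Proof.
move=> p0; rewrite /Lp_norm.
rewrite unlock.
apply: (congr1 (poweR ^~ _)).
rewrite [RHS]integral_mkcond; apply: eq_integral => x _ /=.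
by rewrite !patchE; case: ifPn => // _; rewrite normr0 powR0.
Qed.

Lemma Lp_norm_ge0 p s t f : (0 <= Lp_norm p s t f)%E.
Proof. exact: Lnorm_ge0. Qed.

Lemma le_Lp_norm p s t s' t' f : 0 < p -> measurable_fun `[s', t'] f ->
  s' <= s -> t <= t' -> (Lp_norm p s t f <= Lp_norm p s' t' f)%E.
Proof.
move=> p0 mf ss tt; rewrite !Lp_normE ?gt_eqF//.
have I0 u v : (\int[mu]_(x in `[u, v]) (`|f x| `^ p)%:E)%E \in `[0%E, +oo%E].
  by rewrite in_itv/= leey andbT integral_ge0// => x _; rewrite lee_fin powR_ge0.
apply: gt0_ler_poweR => //; first by rewrite invr_ge0 ltW.
apply: ge0_subset_integral => //.
- apply/measurable_EFinP; apply: (measurableT_comp (measurable_powR p)).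
  exact: measurableT_comp.
- by apply: subset_itvScc.
Qed.

Lemma integral_le_Lp_norm p s t f : 1 < p -> s <= t -> measurable_fun `[s, t] f ->
  (\int[mu]_(x in `[s, t]) `|f x|%:E <=
   Lp_norm p s t f * ((t - s) `^ (1 - p^-1))%:E)%E.
Proof.
move=> p1 st mf; have p0 : 0 < p by apply: lt_trans p1.
have a0 : 0 < 1 - p^-1 by rewrite subr_gt0 invf_lt1.
pose q := (1 - p^-1)^-1; have q0 : 0 < q by rewrite invr_gt0.
have m1 : measurable_fun [set: R] (\1_(`[s, t]%classic) : R -> R).
  exact: measurable_indic.
have mf' : measurable_fun [set: R] (f \_ `[s, t]).
  exact/(measurable_restrictT _ _).1.
have := hoelder mu mf' m1 p0 q0.
rewrite invrK subrKC => /(_ erefl); rewrite Lnorm1.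
have -> : (\int[mu]_x `|(EFin \o ((f \_ `[s, t]) \* \1_(`[s, t]%classic))%R) x| =
    \int[mu]_(x in `[s, t]) `|f x|%:E)%E.
  rewrite [RHS]integral_mkcond; apply: eq_integral => x _ /=.
  rewrite !patchE indicE; case: (x \in _) => /=; last by rewrite mulr0 normr0.
  by rewrite mulr1.
move=> /le_trans; apply; apply: lee_pmul; rewrite ?Lnorm_ge0// unlock.
under eq_integral => x _.
  rewrite /= indicE normr_nat (_ : (_ `^ q)%R = (x \in `[s, t]%classic)%:R); last first.
    by case: (_ \in _); rewrite ?powR1 ?powR0// gt_eqF.
  rewrite -indicE.
over.
have muE : mu `[s, t] = (t - s)%:E.
  rewrite lebesgue_measure_itv/= lte_fin.
  by case: ltgtP st => // ->; rewrite subrr.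
by rewrite integral_indic// setIT [X in (X `^ _)%E]muE /q invrK poweR_EFin.
Qed.

End Lp_norm.

Section powR_extra.
Context {R : realType}.
Implicit Types (a b x y : R).

Lemma continuous_norm_powR a : 0 < a -> continuous (fun x : R => `|x| `^ a).
Proof.
move=> a0 x; have [->|x0] := eqVneq x 0.
  apply/cvgrPdist_lt => e e0; rewrite normr0 powR0 ?gt_eqF//.
  have d0 : 0 < e `^ a^-1 by rewrite powR_gt0.
  apply: filterS (nbhsx_ballx (0 : R) _ d0) => y.
  rewrite /ball/= !sub0r !normrN => yd.
  rewrite ger0_norm ?powR_ge0//.
  have -> : e = (e `^ a^-1) `^ a by rewrite -powRrM mulVf ?gt_eqF// powRr1// ltW.
  by rewrite gt0_ltr_powR// nnegrE ?powR_ge0.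
suff : {for x, continuous ((fun y : R => y `^ a) \o (@Num.norm R R))} by [].
apply: continuous_comp; first exact: norm_continuous.
apply: differentiable_continuous; apply/derivable1_diffP.
by apply: derivable_powR; rewrite in_itv/= andbT normr_gt0.
Qed.

Lemma powR_hoelder2 p a b x y : 1 < p -> 0 <= a -> 0 <= b -> 0 <= x -> 0 <= y ->
  a `^ p^-1 * x `^ (1 - p^-1) + b `^ p^-1 * y `^ (1 - p^-1) <=
  (a + b) `^ p^-1 * (x + y) `^ (1 - p^-1).
Proof.
move=> p1 a0 b0 x0 y0; have p0 : 0 < p by apply: lt_trans p1.
have q0 : 0 < 1 - p^-1 by rewrite subr_gt0 invf_lt1.
have := @hoelder2 R (a `^ p^-1) (b `^ p^-1) (x `^ (1 - p^-1)) (y `^ (1 - p^-1))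
  p (1 - p^-1)^-1 (powR_ge0 _ _) (powR_ge0 _ _) (powR_ge0 _ _) (powR_ge0 _ _) p0.
rewrite invr_gt0 invrK subrKC => /(_ q0 erefl).
by rewrite -!powRrM mulVf ?mulfV ?gt_eqF// !powRr1.
Qed.

End powR_extra.

Section superadditive.
Context {R : realType}.

Lemma total_variation_superadditive (w : R -> R -> R) (h : R -> R) (a b s t : R) :
  (forall s t, a <= s -> s <= t -> t <= b -> `|h t - h s| <= w s t) ->
  (forall s t u, a <= s -> s <= t -> t <= u -> u <= b -> w s t + w t u <= w s u) ->
  a <= s -> s <= t -> t <= b -> (total_variation s t h <= (w s t)%:E)%E.
Proof.
move=> hw ww as_ st tb; apply: ge_ereal_sup => _ [_ [l stl <-] <-].
rewrite lee_fin; elim: l s as_ st stl => [|x l ih] s as_ st stl.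
  by rewrite /variation/= big_geq// (le_trans _ (hw _ _ as_ st tb)).
have [/= /andP[sx xl] lt] := stl.
have xt : x <= t by apply: (itv_partition_le (s := l)).
rewrite /variation/= big_nat_recl//=; apply: le_trans (ww s x t as_ (ltW sx) xt tb).
apply: lerD; first exact: hw (ltW sx) (le_trans xt tb).
by apply: ih => //; exact: le_trans (ltW sx).
Qed.

End superadditive.

Section W1p_paths.
Context {R : realType}.
Variables (p : R) (h : R -> R).
Hypotheses (p1 : 1 < p) (hW : W1p p h).
Implicit Types s t u x : R.
Local Notation mu := (@lebesgue_measure R).

Let p0 : 0 < p. Proof. exact: lt_trans p1. Qed.

Let a0 : 0 < 1 - p^-1. Proof. by rewrite subr_gt0 invf_lt1. Qed.

Let k x := `|(derive1 h \_ `[0, 1]) x| `^ p.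

(* Starting the integral at -1 makes K continuous at every point of [0, 1]. *)
Let K t := \int[mu]_(x in `[-1, t]) k x.

Let integrable_k (i : interval R) : mu.-integrable [set` i] (EFin \o k).
Proof.
have [_ hL] := hW; apply: (integrableS _ _ _ (Lfun_integrable (ltW p1) hL)) => //.
Qed.

Lemma W1p_measurable_derive1 : measurable_fun `[(0 : R), 1] (derive1 h).
Proof.
have [_ /sub_Lfun_mfun] := hW; rewrite inE/= => mh.
exact/(measurable_restrictT _ _).2.
Qed.

Let KB s t : -1 <= s -> s <= t -> K t - K s = \int[mu]_(x in `[s, t]) k x.
Proof.
move=> s1 st; rewrite /K Rintegral_itvB ?bnd_simp//.
exact: Rintegral_itv_obnd_cbnd.
Qed.

Let K_nd s t : -1 <= s -> s <= t -> K s <= K t.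
Proof.
by move=> s1 st; rewrite -subr_ge0 KB//; apply: Rintegral_ge0 => x _; exact: powR_ge0.
Qed.

Let W1p_seminormE s t : 0 <= s -> s <= t -> t <= 1 ->
  W1p_seminorm p s t h = ((K t - K s) `^ p^-1)%:E.
Proof.
move=> s0 st t1; rewrite /W1p_seminorm Lp_normE ?gt_eqF// KB//; last lra.
rewrite -poweR_EFin /Rintegral fineK; last first.
  by apply: integrable_fin_num => //; exact: integrable_k.
apply: (congr1 (poweR ^~ _)); apply: eq_integral => x.
rewrite inE/= in_itv/= => /andP[sx xt].
by rewrite /k patchE mem_set//= in_itv/= (le_trans s0 sx) (le_trans xt t1).
Qed.

Lemma W1p_seminorm_fin_num s t : 0 <= s -> s <= t -> t <= 1 ->
  W1p_seminorm p s t h \is a fin_num.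
Proof. by move=> s0 st t1; rewrite W1p_seminormE. Qed.

Let omega s t := fine (W1p_seminorm p s t h) * (t - s) `^ (1 - p^-1).

Lemma W1p_control : is_control omega.
Proof.
split.
- apply: (@subspace_eq_continuous _ _ _
    (fun st : R * R => `|K st.2 - K st.1| `^ p^-1 *
                       `|st.2 - st.1| `^ (1 - p^-1))).
    move=> [s t]; rewrite inE => -[/= s0 st t1].
    rewrite -[RHS]/(omega s t) /omega W1p_seminormE//= !ger0_norm ?subr_ge0//.
    by apply: K_nd => //; lra.
  apply: continuous_in_subspaceT => -[s t]; rewrite inE => -[/= s0 st t1].
  have cK x : 0 <= x -> x <= 1 -> {for x, continuous K}.
    move=> x0 x1; have := @parameterized_integral_continuous R (-1) 2 k.
    have m12 : (-1 : R) < 2 by lra.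
    move=> /(_ (ltW m12) (integrable_k _)) /(continuous_within_itvP _ m12)[+ _ _].
    by apply; rewrite in_itv/=; apply/andP; lra.
  have cK1 : {for (s, t), continuous (fun st : R * R => K st.1)}.
    apply: (@continuous_comp _ _ _ fst K); first exact: cvg_fst.
    by apply: cK => //; exact: le_trans t1.
  have cK2 : {for (s, t), continuous (fun st : R * R => K st.2)}.
    apply: (@continuous_comp _ _ _ snd K); first exact: cvg_snd.
    by apply: cK => //; exact: le_trans st.
  have cA : {for (s, t), continuous ((fun x : R => `|x| `^ p^-1) \o
      ((fun st : R * R => K st.2) - (fun st : R * R => K st.1)))}.
    apply: continuous_comp; first exact: continuousB.
    by apply: continuous_norm_powR; rewrite invr_gt0.
  have cB : {for (s, t), continuous ((fun x : R => `|x| `^ (1 - p^-1)) \o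
      ((fun st : R * R => st.2) - (fun st : R * R => st.1)))}.
    apply: continuous_comp; last exact: continuous_norm_powR.
    by apply: continuousB; [exact: cvg_snd|exact: cvg_fst].
  exact: (continuousM cA cB).
- by move=> s t _ _ _; rewrite mulr_ge0 ?powR_ge0// fine_ge0 ?Lp_norm_ge0.
- move=> s t u s0 st tu u1.
  have [t0 t1 su] : [/\ 0 <= t, t <= 1 & s <= u] by split; lra.
  rewrite /omega !W1p_seminormE//=.
  have s1 : -1 <= s by lra.
  rewrite (_ : K u - K s = (K t - K s) + (K u - K t)); last lra.
  rewrite (_ : u - s = (t - s) + (u - t)); last lra.
  by apply: powR_hoelder2; rewrite ?subr_ge0 ?K_nd// (le_trans s1 st).
Qed.

Lemma W1p_dist_le s t : 0 <= s -> s <= t -> t <= 1 -> `|h t - h s| <= omega s t.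
Proof.
move=> s0 st t1; have [ach _] := hW.
rewrite -lee_fin EFinM fineK ?W1p_seminorm_fin_num//.
apply: le_trans (integral_le_Lp_norm p1 st _).
  exact: (abs_continuous_dist_le_integral ach W1p_measurable_derive1).
apply: measurable_funS W1p_measurable_derive1 => //.
by apply: subset_itvScc; rewrite bnd_simp.
Qed.

Lemma W1p_qvar1_le s t : 0 <= s -> s <= t -> t <= 1 ->
  (qvar 1 s t h <= (omega s t)%:E)%E.
Proof.
move=> s0 st t1; rewrite qvar1; have [_ _ omegaD] := W1p_control.
exact: (total_variation_superadditive W1p_dist_le omegaD).
Qed.

End W1p_paths.

Section embeddings.
Context {R : realType}.
Variables (p : R) (h : R -> R).
Hypotheses (p1 : 1 < p) (hW : W1p p h).
Implicit Types s t x : R.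
Local Notation mu := (@lebesgue_measure R).

Let p0 : 0 < p. Proof. exact: lt_trans p1. Qed.

Let a0 : 0 < 1 - p^-1. Proof. by rewrite subr_gt0 invf_lt1. Qed.

Let w := fine (W1p_seminorm p 0 1 h).

Let wE : w%:E = W1p_seminorm p 0 1 h.
Proof. by rewrite fineK// W1p_seminorm_fin_num. Qed.

Let w0 : 0 <= w. Proof. exact/fine_ge0/Lp_norm_ge0. Qed.

Let dist_le s t : 0 <= s -> s <= t -> t <= 1 ->
  `|h t - h s| <= w * (t - s) `^ (1 - p^-1).
Proof.
move=> s0 st t1; apply: le_trans (W1p_dist_le p1 hW s0 st t1) _.
rewrite ler_wpM2r ?powR_ge0// -lee_fin wE fineK ?W1p_seminorm_fin_num//.
apply: le_Lp_norm => //; exact: W1p_measurable_derive1 hW.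
Qed.

Lemma W1p_hoelder_seminorm_le :
  (hoelder_seminorm (1 - p^-1) h <= W1p_seminorm p 0 1 h)%E.
Proof.
rewrite -wE; apply: ge_ereal_sup => _ [[s t] /= [s0 st t1] <-].
rewrite lee_fin /= (gtr0_norm (x := t - s)) ?subr_gt0// ler_pdivrMr ?powR_gt0 ?subr_gt0//.
exact: dist_le (ltW st) t1.
Qed.

Lemma W1p_sup_norm_le : (sup_norm h <= W1p_norm p h)%E.
Proof.
apply: ge_ereal_sup => _ [t t01 <-]; move: t01 => /=; rewrite in_itv/= => /andP[t0 t1].
have [ach _] := hW.
have mh : measurable_fun `[(0 : R), 1] h.
  apply: subspace_continuous_measurable_fun => //.
  exact: abs_continuous_within.
have hs s : 0 <= s -> s <= 1 -> `|h t| <= `|h s| + w.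
  move=> s0 s1; rewrite -lerBlDl (le_trans (lerB_dist _ _))//.
  wlog st : s t t0 t1 s0 s1 / s <= t.
    by move=> wl; have [|/ltW] := leP s t; [exact: wl|rewrite distrC; exact: wl].
  apply: le_trans (dist_le s0 st t1) _; rewrite ler_piMr//.
  have : (t - s) `^ (1 - p^-1) <= 1 `^ (1 - p^-1).
    apply: (ge0_ler_powR (ltW a0)); rewrite ?nnegrE ?subr_ge0//.
    by rewrite lerBlDr (le_trans t1)// lerDl.
  by rewrite powR1.
have mu01 : mu `[(0 : R), 1] = 1%E.
  by rewrite lebesgue_measure_itv/= lte_fin ltr01 sube0.
rewrite /W1p_norm -wE.
apply: (@le_trans _ _ (\int[mu]_(x in `[0%R, 1%R]) (`|h x|%:E + w%:E))%E).
  rewrite -[leLHS]mule1 -mu01 -integral_cst//.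
  apply: ge0_le_integral => //.
  - by move=> x _; rewrite lee_fin.
  - by apply: emeasurable_funD => //; apply/measurable_EFinP; exact: measurableT_comp.
  - by move=> x /=; rewrite in_itv/= => /andP[x0 x1]; rewrite -EFinD lee_fin hs.
rewrite ge0_integralD//; last by apply/measurable_EFinP; exact: measurableT_comp.
rewrite integral_cst// [X in (_ + _ * X)%E]mu01 mule1 leeD2r//.
have := integral_le_Lp_norm p1 ler01 mh.
by rewrite subr0 powR1 mule1.
Qed.

End embeddings.

Theorem theorem1 (R : realType) (p alpha : R) (hp : 1 < p)
    (halpha : alpha = 1 - p^-1) :
  0 < alpha /\
  (forall h : R -> R, W1p p h ->
     let omega := fun s t : R =>
       fine (W1p_seminorm p s t h) * (t - s) `^ alpha in
     is_control omega /\
     (forall s t : R, 0 <= s -> s <= t -> t <= 1 ->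
        (qvar 1 s t h <= (omega s t)%:E)%E)) /\
  continuous_embedding (W1p p) (W1p_norm p)
    (Choelder alpha) (Choelder_norm alpha) /\
  continuous_embedding (W1p p) (W1p_norm p)
    (Cqvar 1) (Cqvar_norm 1).
Proof.
have seminorm_lty h : W1p p h -> (W1p_seminorm p 0 1 h < +oo)%E.
  by move=> hW; rewrite ltey_eq (W1p_seminorm_fin_num hp hW).
have norm_le h (N M : \bar R) : W1p p h -> (N <= W1p_norm p h)%E ->
    (M <= W1p_seminorm p 0 1 h)%E -> (N + M <= 2%:E * W1p_norm p h)%E.
  move=> hW Nh Mh; rewrite mule_natl mule2n leeD// (le_trans Mh)//.
  by rewrite leeDr// Lp_norm_ge0.
have qvar_le h : W1p p h -> (qvar 1 0 1 h <= W1p_seminorm p 0 1 h)%E.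
  move=> hW; have := W1p_qvar1_le hp hW (lexx 0) ler01 (lexx 1).
  by rewrite subr0 powR1 mulr1 fineK// (W1p_seminorm_fin_num hp hW).
rewrite halpha; split; first by rewrite subr_gt0 invf_lt1// (lt_trans _ hp).
split; first by move=> h hW; split; [exact: W1p_control|exact: W1p_qvar1_le].
split; split.
- by move=> h hW; exact: le_lt_trans (W1p_hoelder_seminorm_le hp hW) (seminorm_lty _ hW).
- exists 2 => h hW.
  exact: norm_le (W1p_sup_norm_le hp hW) (W1p_hoelder_seminorm_le hp hW).
- move=> h hW; split; last exact: le_lt_trans (qvar_le _ hW) (seminorm_lty _ hW).
  by apply: abs_continuous_within; case: hW.
- exists 2 => h hW; exact: norm_le (W1p_sup_norm_le hp hW) (qvar_le _ hW).
Qed.
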